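(* Let $k\geq 2$ be an integer and, for $n\geq 0$, let $a_{k,n}$ denote the number of even-up words over $k$ of length $n$. Let $A_k(x)=\sum_{n\geq 0}a_{k,n}x^n$. Then \[A_k(x)=\frac{(x+1)^{\lfloor k/2\rfloor}}{2-(x+1)^{\lfloor (k+1)/2\rfloor}}.\]
   Context: For an integer $k\geq 2$, let $[k]=\{1,\ldots,k\}$. A word over $k$ of length $n$ is an element $w_1\cdots w_n\in[k]^n$ (for $n=0$ there is exactly one word, the empty word). A word $w_1\cdots w_n\in[k]^n$ is even-up if for every $i\in[n-1]$, whenever $w_i$ is even, $w_{i+1}>w_i$. *)

(* Defs.v *)
From HB Require Import structures.
From mathcomp Require Import all_boot all_order all_algebra.
From mathcomp Require Import boolp.

Set Implicit Arguments.
Unset Strict Implicit.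
Unset Printing Implicit Defensive.

Import GRing.Theory.
Local Open Scope ring_scope.

(** * Formal power series R[[x]], as a comUnitRingType *)

Record fps (R : comUnitRingType) := Fps { coefs : nat -> R }.

Arguments Fps {R} coefs.

Notation "{ 'fps' R }" := (fps R) (at level 0, format "{ 'fps'  R }").

Section FpsRing.
Variable R : comUnitRingType.
Implicit Types f g h : {fps R}.

Lemma fpsP f g : coefs f =1 coefs g -> f = g.
Proof. by case: f g => [f] [g] /= /funext ->. Qed.

HB.instance Definition _ := gen_eqMixin {fps R}.
HB.instance Definition _ := gen_choiceMixin {fps R}.

Definition fps_zero : {fps R} := Fps (fun=> 0).
Definition fps_opp f : {fps R} := Fps (fun n => - coefs f n).
Definition fps_add f g : {fps R} := Fps (fun n => coefs f n + coefs g n).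

Fact fps_addA : associative fps_add.
Proof. by move=> f g h; apply: fpsP => n /=; rewrite addrA. Qed.
Fact fps_addC : commutative fps_add.
Proof. by move=> f g; apply: fpsP => n /=; rewrite addrC. Qed.
Fact fps_add0 : left_id fps_zero fps_add.
Proof. by move=> f; apply: fpsP => n /=; rewrite add0r. Qed.
Fact fps_addN : left_inverse fps_zero fps_opp fps_add.
Proof. by move=> f; apply: fpsP => n /=; rewrite addNr. Qed.

HB.instance Definition _ :=
  GRing.isZmodule.Build {fps R} fps_addA fps_addC fps_add0 fps_addN.

Definition fps_one : {fps R} := Fps (fun n => (n == 0)%:R).
Definition fps_mul f g : {fps R} :=
  Fps (fun n => \sum_(i < n.+1) coefs f i * coefs g (n - i)).

(* Truncation to a polynomial; reduces the ring axioms to those of {poly R}. *)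
Definition fps_trunc N f : {poly R} := \poly_(i < N.+1) coefs f i.

Lemma coef_fps_trunc N f i : (i <= N)%N -> (fps_trunc N f)`_i = coefs f i.
Proof. by move=> leiN; rewrite coef_poly ltnS leiN. Qed.

Lemma coefs_mul_trunc N f g n : (n <= N)%N ->
  coefs (fps_mul f g) n = (fps_trunc N f * fps_trunc N g)`_n.
Proof.
move=> lenN; rewrite coefM; apply: eq_bigr => i _.
rewrite !coef_fps_trunc ?(leq_trans (leq_subr _ _)) //.
exact: leq_trans (ltn_ord i : (i <= n)%N) lenN.
Qed.

Fact fps_mulC : commutative fps_mul.
Proof. by move=> f g; apply: fpsP => n; rewrite !(@coefs_mul_trunc n) // mulrC. Qed.

Fact fps_mulA : associative fps_mul.
Proof.
move=> f g h; apply: fpsP => n.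
transitivity ((fps_trunc n f * (fps_trunc n g * fps_trunc n h))`_n).
  rewrite coefM; apply: eq_bigr => i _.
  rewrite coef_fps_trunc ?(ltn_ord i : (i <= n)%N) //.
  by rewrite (@coefs_mul_trunc n) ?leq_subr.
rewrite mulrA coefM; apply: eq_bigr => i _.
rewrite coef_fps_trunc ?leq_subr // -coefs_mul_trunc //.
exact: (ltn_ord i : (i <= n)%N).
Qed.

Fact fps_mul1 : left_id fps_one fps_mul.
Proof.
move=> f; apply: fpsP => n /=.
by rewrite big_ord_recl /= mul1r subn0 big1 ?addr0 // => i _; rewrite mul0r.
Qed.

Fact fps_mulD : left_distributive fps_mul fps_add.
Proof.
move=> f g h; apply: fpsP => n /=.
by rewrite -big_split; apply: eq_bigr => i _; rewrite /= mulrDl.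
Qed.

Fact fps_one_neq0 : fps_one != 0.
Proof.
apply/eqP => /(congr1 (fun f => coefs f 0)) /= /eqP.
by rewrite oner_eq0.
Qed.

HB.instance Definition _ := GRing.Zmodule_isComNzRing.Build {fps R}
  fps_mulA fps_mulC fps_mul1 fps_mulD fps_one_neq0.

Definition fps_unit : {pred {fps R}} := fun f => coefs f 0 \is a GRing.unit.

(* The first n coefficients g_0, ..., g_{n-1} of g = f^-1, obtained by solving
   \sum_(i <= m) g_i * f_{m-i} = (m == 0)%:R successively for g_m. *)
Fixpoint fps_inv_seq f n : seq R :=
  if n is m.+1 then
    let s := fps_inv_seq f m in
    rcons s (((m == 0)%:R - \sum_(i < m) s`_i * coefs f (m - i)) / coefs f 0)
  else [::].

(* As for every unitRingType, the inverse of a non-unit is itself. *)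
Definition fps_inv f : {fps R} :=
  if f \in fps_unit then Fps (fun n => (fps_inv_seq f n.+1)`_n) else f.

Lemma size_fps_inv_seq f n : size (fps_inv_seq f n) = n.
Proof. by elim: n => //= n IHn; rewrite size_rcons IHn. Qed.

Lemma nth_fps_inv_seq f n i : (i < n)%N ->
  (fps_inv_seq f n)`_i = (fps_inv_seq f i.+1)`_i.
Proof.
elim: n => // n IHn; rewrite ltnS leq_eqVlt => /predU1P[-> // | ltin].
by rewrite [LHS]/= nth_rcons size_fps_inv_seq ltin IHn.
Qed.

Fact fps_mulVx : {in fps_unit, left_inverse 1 fps_inv *%R}.
Proof.
move=> f Uf; apply: fpsP => n; rewrite /fps_inv Uf /=.
rewrite big_ord_recr /= subnn [X in _ + X * _]nth_rcons size_fps_inv_seq.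
rewrite ltnn eqxx divrK // addrC.
rewrite -[RHS](subrK (\sum_(i < n) (fps_inv_seq f n)`_i * coefs f (n - i))).
congr (_ + _); apply: eq_bigr => i _.
by rewrite -[rcons _ _]/(fps_inv_seq f i.+1) -(nth_fps_inv_seq f (ltn_ord i)).
Qed.

Fact fps_unitPl f g : g * f = 1 -> fps_unit f.
Proof.
move=> /(congr1 (fun h => coefs h 0)) /=; rewrite big_ord1 => gf1.
by apply/unitrPr; exists (coefs g 0); rewrite mulrC.
Qed.

Fact fps_inv_out : {in [predC fps_unit], fps_inv =1 id}.
Proof. by move=> f; rewrite inE /= /fps_inv => /negbTE ->. Qed.

HB.instance Definition _ := GRing.ComNzRing_hasMulInverse.Build {fps R}
  fps_mulVx fps_unitPl fps_inv_out.

Definition fpsX : {fps R} := Fps (fun n => (n == 1)%:R).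

End FpsRing.

Arguments fpsX {R}.

(** * Even-up words *)

Local Open Scope nat_scope.

(* [k] = {1, ..., k} is encoded by 'I_k = {0, ..., k-1}; parity is that of the
   letter, so it is essential to shift before testing it. *)
Definition letter k (x : 'I_k) : nat := x.+1.

Definition even_up k n (w : n.-tuple 'I_k) : bool :=
  [forall i : 'I_n, forall j : 'I_n, (val j == (val i).+1) ==>
    ~~ odd (letter (tnth w i)) ==> (letter (tnth w i) < letter (tnth w j))].

Definition num_even_up k n : nat := #|[set w : n.-tuple 'I_k | even_up w]|.

Definition even_up_gf k : {fps int} := Fps (fun n => (num_even_up k n)%:Z%R).

(* Main.v *)
Require Import Defs.
From mathcomp Require Import all_boot all_order all_algebra.
From mathcomp Require Import ring zify.

(** Let [A] be the generating function and [G a] that of the even-up words that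
are empty or begin with a letter greater than [a], so that [G 0 = A] and
[G k = 1].  Removing the first letter gives [G (a - 1) = G a + x G a] for [a]
even and [G (a - 1) = G a + x A] for [a] odd.  Hence [G a + A] is multiplied by
[1 + x] each time [a] decreases by [2] through an odd-even pair of letters, and
iterating from [a = k] (or [a = k - 1]) down to [0] gives a linear equation
for [A]. *)

Set Implicit Arguments.
Unset Strict Implicit.
Unset Printing Implicit Defensive.

Import GRing.Theory.

Local Open Scope nat_scope.

Section EvenUpWords.
Variable k : nat.

Definition even_up_rel : rel 'I_k :=
  fun x y => ~~ odd (letter x) ==> (letter x < letter y).

Lemma even_up_sorted n (w : n.-tuple 'I_k) :
  even_up w = sorted even_up_rel w.
Proof.
case: w => [[|x s] sz_w]; rewrite /even_up /=.
  by apply/forallP => -[i lt_i]; exfalso; move: lt_i; rewrite -(eqP sz_w).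
have sz : (size s).+1 = n := eqP sz_w.
(* [pathP] compares entry [i] of [x :: s] with entry [i] of [s], which is entry [i.+1] of the word;
   so [i] ranges below [size s], one less than [n]. *)
apply/forallP/(pathP x) => [up i lt_i | up i].
  have lt_i2 : i.+1 < n by rewrite -sz ltnS.
  have lt_i1 : i < n by exact: ltnW.
  move/forallP: (up (Ordinal lt_i1)) => /(_ (Ordinal lt_i2)) /=.
  by rewrite eqxx !(tnth_nth x).
apply/forallP => j; apply/implyP => /eqP def_j.
have lt_i : val i < size s by rewrite -ltnS sz -def_j ltn_ord.
by have := up _ lt_i; rewrite !(tnth_nth x) /= def_j.
Qed.

(* Letters are shifted by one in ['I_k]: the first letter is greater than [a]
   exactly when its index is at least [a]. *)
Definition even_up_above a (s : seq 'I_k) : bool :=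
  (if s is x :: _ then a <= x else true) && sorted even_up_rel s.

Definition num_above a n : nat :=
  #|[set w : n.-tuple 'I_k | even_up_above a w]|.

Lemma num_above0 n : num_above 0 n = num_even_up k n.
Proof.
apply: eq_card => w; rewrite !inE even_up_sorted /even_up_above.
by case: (tval w).
Qed.

Lemma num_above_nil a : num_above a 0 = 1.
Proof.
rewrite -[RHS](expn0 #|'I_k|) -card_tuple.
by apply: eq_card => w; rewrite !inE tuple0.
Qed.

Lemma num_above_max n : num_above k n.+1 = 0.
Proof.
apply: eq_card0 => w; rewrite !inE; case/tupleP: w => x w.
by rewrite /even_up_above /= leqNgt ltn_ord.
Qed.

(** The second summand counts the tails of the words whose first index is exactly [a]. That letter
    is [a.+1], even when [a] is odd: the tail must then be empty or start at index at least [a.+1].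
    Otherwise any even-up tail is allowed. *)
Lemma num_above_cons a n : a < k ->
  num_above a n.+1 =
  num_above a.+1 n.+1 + num_above (if odd a then a.+1 else 0) n.
Proof.
move=> lt_ak; pose x := Ordinal lt_ak.
pose b := if odd a then a.+1 else 0.
pose T := [set w : n.-tuple 'I_k | even_up_above b w].
have cons_inj : injective (fun w : n.-tuple 'I_k => [tuple of x :: w]).
  by move=> w1 w2 /(congr1 val) [] /val_inj.
have pathE (w : seq 'I_k) : path even_up_rel x w = even_up_above b w.
  case: w => //= y w; rewrite /even_up_above /even_up_rel /letter /b /=.
  by rewrite negbK; case: (odd a).
(* The sum of two cardinals becomes that of a union [U] and an intersection [I], which is empty
   because a first index [a] violates the bound [a.+1]. *)
rewrite /num_above -/b -/T -(card_imset _ cons_inj) -cardsUI.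
set U := _ :|: _; set I := _ :&: _.
have -> : I = set0.
  apply/setP => w; rewrite !inE; apply/negP => /andP[w_above].
  by case/imsetP=> v _ def_w; rewrite def_w /even_up_above /= ltnn in w_above.
rewrite cards0 addn0; apply: eq_card => w; rewrite !inE.
case/tupleP: w => y w; rewrite /even_up_above /=.
rewrite leq_eqVlt andb_orl orbC; congr (_ || _).
apply/andP/imsetP => [[/eqP ay path_w] | [v]].
  have def_y : y = x by apply: val_inj.
  by exists w; [rewrite inE -pathE -def_y | apply: val_inj; rewrite /= def_y].
by rewrite inE -pathE => path_v /(congr1 val) /= [-> ->].
Qed.

End EvenUpWords.

Local Open Scope ring_scope.

Lemma coefs_fpsXM (R : comUnitRingType) (f : {fps R}) n :
  coefs (fpsX * f) n = if n is m.+1 then coefs f m else 0.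
Proof.
case: n => [|n]; first by rewrite /= big_ord1 mul0r.
rewrite /= big_ord_recl mul0r add0r big_ord_recl mul1r subSS subn0.
by rewrite big1 ?addr0 // => i _; rewrite mul0r.
Qed.

Section GeneratingFunction.
Variable k : nat.

Definition gf_above a : {fps int} := Fps (fun n => (num_above k a n)%:Z).

Lemma gf_above0 : gf_above 0 = even_up_gf k.
Proof. by apply: fpsP => n /=; rewrite num_above0. Qed.

Lemma gf_above_max : gf_above k = 1.
Proof.
by apply: fpsP => -[|n] /=; rewrite ?num_above_nil // num_above_max.
Qed.

Lemma gf_above_cons a : (a < k)%N ->
  gf_above a = gf_above a.+1 + fpsX * gf_above (if odd a then a.+1 else 0).
Proof.
move=> lt_ak; apply: fpsP => n.
rewrite -[RHS]/(coefs (gf_above a.+1) n + coefs (fpsX * _) n) coefs_fpsXM.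
case: n => [|n] /=; first by rewrite !num_above_nil.
by rewrite num_above_cons // PoszD.
Qed.

Lemma gf_above_pairs j : (j.*2 <= k)%N ->
  gf_above 0 + gf_above 0 = (fpsX + 1) ^+ j * (gf_above j.*2 + gf_above 0).
Proof.
elim: j => [|j IHj]; first by rewrite mul1r.
rewrite doubleS => lt_jk; rewrite IHj; last by lia.
(* Index [j.*2] carries an odd letter and [j.*2.+1] an even one, so both forms of the recurrence are
   used once. *)
rewrite (@gf_above_cons j.*2) ?(@gf_above_cons j.*2.+1) /= ?odd_double; try lia.
rewrite exprS /=; ring.
Qed.

Lemma even_up_gf_linear :
  even_up_gf k * (2 - (fpsX + 1) ^+ ((k + 1) %/ 2)) = (fpsX + 1) ^+ (k %/ 2).
Proof.
rewrite -gf_above0 !divn2 addn1 /=; set A := gf_above 0.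
have le_k : (k./2.*2 <= k)%N by lia.
have := gf_above_pairs le_k; rewrite -/A.
have [odd_k | even_k] := boolP (odd k).
  have def_k : k./2.*2.+1 = k by lia.
  (* The letter [k] is odd and unpaired: one more step gives [1 + fpsX * A], and adding [A] produces
     the extra factor [fpsX + 1] in the denominator. *)
  rewrite gf_above_cons; last by lia.
  rewrite def_k gf_above_max odd_double uphalf_half odd_k add1n exprS -/A => eqA.
  by rewrite mulrBr mulr_natr mulr2n eqA; ring.
have def_k : k./2.*2 = k by lia.
rewrite def_k gf_above_max uphalf_half (negbTE even_k) add0n => eqA.
by rewrite mulrBr mulr_natr mulr2n eqA; ring.
Qed.

End GeneratingFunction.

(** The constant coefficient is [2 - 1 = 1], invertible in the integers. *)
Lemma unit_two_sub_X1_exp m :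
  (2 - (fpsX + 1) ^+ m : {fps int}) \is a GRing.unit.
Proof.
have coef0X : coefs ((fpsX + 1 : {fps int}) ^+ m) 0 = 1.
  elim: m => //= m IHm; rewrite exprS mulrDl mul1r.
  by rewrite -[LHS]/(coefs (fpsX * _) 0 + _) coefs_fpsXM add0r.
change (coefs (2 - (fpsX + 1) ^+ m : {fps int}) 0 \is a GRing.unit).
by rewrite /= coef0X.
Qed.

Theorem theorem1 (k : nat) (hk : (2 <= k)%N) :
  even_up_gf k =
    (fpsX + 1) ^+ (k %/ 2) / (2 - (fpsX + 1) ^+ ((k + 1) %/ 2)) :> {fps int}.
Proof. by rewrite -even_up_gf_linear mulrK ?unit_two_sub_X1_exp. Qed.
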